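(* For every integer $n > 9$, Player $2$ has a winning strategy in the two-player Tribonacci game starting from $n$ copies of $T_1 = 1$.
   Context: The Tribonacci numbers are defined by $T_1 = 1$, $T_2 = 2$, $T_3 = 4$ and $T_{i+1} = T_i + T_{i-1} + T_{i-2}$ for $i \ge 3$. The two-player Tribonacci game on $n$: a position is a finite unordered list (multiset) of Tribonacci numbers; the initial position consists of $n$ copies of $T_1$. Players $1$ and $2$ alternate turns, Player $1$ moving first. On each turn the player whose turn it is makes one of the following moves, provided the terms on the left are present in the list (with the required multiplicity); they are removed and replaced by the terms on the right: 1. $T_{i-2} \wedge T_{i-1} \wedge T_i \to T_{i+1}$ for $i \ge 3$; 2. $T_1 \wedge T_1 \wedge T_2 \to T_3$; 3. $T_1 \wedge T_1 \to T_2$; $T_2 \wedge T_2 \to T_3$; $T_3 \wedge T_3 \to T_4 \wedge T_1$; and $T_i \wedge T_i \to T_{i+1} \wedge T_{i-3}$ for $i \ge 4$. The game ends when no move is available, and the player who made the final move wins. A player has a winning strategy if that player can guarantee making the final move whatever the opponent does. *)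

(* Defs.v *)
From HB Require Import structures.
From mathcomp Require Import all_boot.
From mathcomp Require Import finmap multiset.

Set Implicit Arguments.
Unset Strict Implicit.
Unset Printing Implicit Defensive.

(* Two-player games, players alternating and Player 1 moving first.          *)
(* A play from [x0] is given by the list [s] of the positions reached after  *)
(* x0: its k-th move (counted from 0) goes from [nth x0 (x0 :: s) k] to      *)
(* [nth x0 s k].                                                             *)

Variant player := Player1 | Player2.

Definition mover (k : nat) : player := if odd k then Player2 else Player1.

(* The position to move to, given all positions so far, initial one first.   *)
Definition strategy (pos : Type) := seq pos -> pos.

Definition is_play (pos : Type) (move : pos -> pos -> Prop) (x0 : pos)
    (s : seq pos) : Prop :=
  forall k, k < size s -> move (nth x0 (x0 :: s) k) (nth x0 s k).

Definition follows (pos : Type) (P : player) (sigma : strategy pos) (x0 : pos)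
    (s : seq pos) : Prop :=
  forall k, k < size s -> mover k = P ->
    nth x0 s k = sigma (take k.+1 (x0 :: s)).

Definition terminal (pos : Type) (move : pos -> pos -> Prop) (x : pos) : Prop :=
  forall y, ~ move x y.

Definition made_final_move (pos : Type) (P : player) (s : seq pos) : Prop :=
  0 < size s /\ mover (size s).-1 = P.

Definition infinite_play (pos : Type) (move : pos -> pos -> Prop) (x0 : pos)
    (f : nat -> pos) : Prop :=
  f 0 = x0 /\ forall k, move (f k) (f k.+1).

Definition infinite_follows (pos : Type) (P : player) (sigma : strategy pos)
    (f : nat -> pos) : Prop :=
  forall k, mover k = P -> f k.+1 = sigma (mkseq f k.+1).

(* [sigma] always proposes a legal move when its player can move, it never   *)
(* allows the game to go on forever, and [P] makes the final move of every   *)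
(* complete play in which [P] follows it.                                    *)
Record winning_strategy (pos : Type) (move : pos -> pos -> Prop) (x0 : pos)
    (P : player) (sigma : strategy pos) : Prop := WinningStrategy {
  ws_legal : forall s, is_play move x0 s -> follows P sigma x0 s ->
    mover (size s) = P -> ~ terminal move (last x0 s) ->
    move (last x0 s) (sigma (x0 :: s));
  ws_ends : forall f, infinite_play move x0 f -> ~ infinite_follows P sigma f;
  ws_wins : forall s, is_play move x0 s -> follows P sigma x0 s ->
    terminal move (last x0 s) -> made_final_move P s
}.

Definition has_winning_strategy (pos : Type) (move : pos -> pos -> Prop)
    (x0 : pos) (P : player) : Prop :=
  exists sigma : strategy pos, winning_strategy move x0 P sigma.

(* Indexed from 1; [trib 0] is a junk value that no move below refers to.    *)
Fixpoint trib (i : nat) : nat :=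
  match i with
  | 0 => 0
  | 1 => 1
  | 2 => 2
  | 3 => 4
  | ((k.+1 as j).+1 as l).+1 => trib l + trib j + trib k
  end.

Local Open Scope mset_scope.

(* Positions contain the Tribonacci numbers themselves, not their indices.   *)
Definition position := {mset nat}.

(* [trib_rule A B]: the terms [A] may be replaced by the terms [B].          *)
Inductive trib_rule : {mset nat} -> {mset nat} -> Prop :=
| rule_consecutive i : (3 <= i)%N ->
    trib_rule [mset trib (i - 2); trib (i - 1); trib i] [mset trib (i + 1)]
| rule_112 : trib_rule [mset trib 1; trib 1; trib 2] [mset trib 3]
| rule_11 : trib_rule [mset trib 1; trib 1] [mset trib 2]
| rule_22 : trib_rule [mset trib 2; trib 2] [mset trib 3]
| rule_33 : trib_rule [mset trib 3; trib 3] [mset trib 4; trib 1]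
| rule_double i : (4 <= i)%N ->
    trib_rule [mset trib i; trib i] [mset trib (i + 1); trib (i - 3)].

Definition trib_move (p q : position) : Prop :=
  exists A B : {mset nat}, [/\ trib_rule A B, A `<=` p & q = (p `\` A) `+` B].

Definition trib_start (n : nat) : position := msetn n (trib 1).

(* Main.v *)
Require Import Defs.
From mathcomp Require Import all_boot.
From mathcomp Require Import finmap multiset zify.
From Stdlib Require Import Classical ClassicalEpsilon.

Set Implicit Arguments.
Unset Strict Implicit.
Unset Printing Implicit Defensive.

Local Open Scope mset_scope.
Local Open Scope nat_scope.

(** The game terminates, because every move preserves the sum of the list and
    increases the sum of the squares of its entries, and a list of sum [n] has
    sum of squares at most [n ^ 2].  Hence every position is either winning or
    losing for the player about to move, and it suffices to show that the
    initial position is losing.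

    This is a strategy-stealing argument.  Write (a, b, c, d) for a copies of
    1, b of 2, c of 4 and d of 7, and let n = m + 10.  Suppose that
    (m+10, 0, 0, 0) is winning.
    - The only way out of it is (m+8, 1, 0, 0), so this is losing.
    - So its successor (m+6, 0, 1, 0) is winning; the only way out of that is
      (m+4, 1, 1, 0), which is therefore losing.
    - So both (m+2, 0, 2, 0) and (m+3, 0, 0, 1), its successors, are winning.
    - The only way out of (m+3, 0, 0, 1) is (m+1, 1, 0, 1), which is therefore
      losing.
    - From (m+2, 0, 2, 0) one can go only to (m, 1, 2, 0) or to
      (m+3, 0, 0, 1); the latter is winning, so (m, 1, 2, 0) is losing.
    But (m, 1, 2, 0) has (m+1, 1, 0, 1) among its successors, and a losing
    position has no losing successor.

    Each list of ways out concerns a position without 2 and with at most one 7;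
    [no_two_move] shows that there the only moves are 1, 1 -> 2 and
    4, 4 -> 7, 1. *)

(** * Winning and losing positions of terminating games *)

Section Games.

Variables (pos : Type) (move : pos -> pos -> Prop).

(** Winning for the player about to move.  Two moves are inlined into one
    constructor so that the definition is strictly positive. *)
Inductive winning (x : pos) : Prop :=
  Winning y of move x y & (forall z, move y z -> winning z).

Definition losing (x : pos) : Prop := forall y, move x y -> winning y.

Lemma winningP x : winning x <-> exists y, move x y /\ losing y.
Proof.
split=> [[y xy ly] | [y [xy ly]]]; first by exists y.
exact: Winning xy ly.
Qed.

(** From a position that is both, the winning move leads to a losing [y], which
    is also winning because the position is losing; the induction on [winning]
    rules this out. *)
Lemma losing_not_winning x : losing x -> ~ winning x.
Proof.
move=> lx wx; elim: wx lx => {}x y xy ly IH lx.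
have [z yz lz] := lx y xy.
exact: IH yz lz.
Qed.

Definition terminating : Prop := well_founded (fun y x => move x y).

Lemma determinacy : terminating -> forall x, winning x \/ losing x.
Proof.
move=> wf; elim/(well_founded_ind wf) => x IH.
case: (classic (exists y, move x y /\ losing y)) => [/winningP|no]; first by left.
right=> y xy; case: (IH y xy) => // ly.
by case: no; exists y.
Qed.

Lemma not_losing_winning : terminating -> forall x, ~ losing x -> winning x.
Proof. by move=> wf x nl; case: (determinacy wf x). Qed.

Definition to_losing (x0 : pos) : strategy pos := fun h =>
  epsilon (inhabits x0) (fun y => move (last x0 h) y /\ losing y).

Lemma to_losingP x0 h : winning (last x0 h) ->
  move (last x0 h) (to_losing x0 h) /\ losing (to_losing x0 h).
Proof. by move/winningP; apply: epsilon_spec. Qed.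

(** When the second player moves to losing positions, the positions after an
    odd number of moves, where that player is on turn, are all winning. *)
Lemma to_losing_invariant x0 s : losing x0 ->
  is_play move x0 s -> follows Player2 (to_losing x0) x0 s ->
  forall k, k <= size s ->
    if odd k then winning (nth x0 (x0 :: s) k) else losing (nth x0 (x0 :: s) k).
Proof.
move=> l0 play fol; elim=> [|k IH] ks //=.
have := IH (ltnW ks); have := play k ks; have := fol k ks.
rewrite /mover; case: (odd k) => /= [-> // _ wk|_ xy lk]; last exact: lk.
have lastE : last x0 (take k.+1 (x0 :: s)) = nth x0 (x0 :: s) k.
  rewrite (last_nth x0) size_takel ?ltnS ?(ltnW ks) //.
  by rewrite -[LHS]/(nth x0 (take k.+1 (x0 :: s)) k) nth_take.
have [] := @to_losingP x0 (take k.+1 (x0 :: s)); last by [].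
by rewrite lastE.
Qed.

(** Without a move out of [x0] the game is over before anyone has moved, and
    then nobody makes the final move: hence the last hypothesis. *)
Lemma losing_second_player_wins x0 :
  terminating -> losing x0 -> ~ terminal move x0 ->
  has_winning_strategy move x0 Player2.
Proof.
move=> wf l0 nt0; exists (to_losing x0); split.
- move=> s play fol turn _.
  have := to_losing_invariant l0 play fol (leqnn (size s)).
  have -> : odd (size s) by move: turn; rewrite /mover; case: odd.
  rewrite -last_nth => ws.
  by have [] := @to_losingP x0 (x0 :: s) ws.
- move=> f [_ fmove] _.
  suff noseq x : forall k, f k = x -> False by exact: (noseq (f 0) 0).
  elim/(well_founded_ind wf): x => x IH k fk.
  by apply: (IH (f k.+1) _ k.+1); rewrite // -fk.
- move=> s play fol term.
  have := to_losing_invariant l0 play fol (leqnn (size s)).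
  rewrite -last_nth; case: ifPn => [_ /winningP[y [xy _]]|even _].
    by case: (term y).
  case: s play fol term even => [|y s] //= play fol term even.
  by split=> //; rewrite /mover /= (negbNE even).
Qed.

End Games.

(** * Termination of the Tribonacci game *)

Lemma trib_ltS i : trib i < trib i.+1.
Proof.
(* The recurrence reaches back three terms, hence three inequalities at once. *)
have step j : [/\ trib j < trib j.+1, trib j.+1 < trib j.+2
                & trib j.+2 < trib j.+3].
  by elim: j => [|j [h0 h1 h2]] //; split=> //=; move: h0 h1 h2 => /=; lia.
by case: (step i).
Qed.

Lemma trib_rec i : trib i.+4 = trib i.+3 + trib i.+2 + trib i.+1.
Proof. by []. Qed.

Lemma trib_double i : trib i.+4 + trib i.+4 = trib i.+4.+1 + trib i.+1.
Proof. rewrite (trib_rec i.+1) (trib_rec i); lia. Qed.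

(** [trib 5] is the first Tribonacci number that the positions of the
    strategy-stealing argument never contain. *)
Lemma trib_gt7 i : 5 <= i -> 7 < trib i.
Proof.
elim: i => // i IH; rewrite leq_eqVlt => /predU1P[[<-] //|/IH lt7].
exact: leq_trans lt7 (ltnW (trib_ltS i)).
Qed.

Definition total (f : nat -> nat) (p : {mset nat}) : nat := \sum_(x <- p) f x.

Lemma totalD f (p q : {mset nat}) : total f (p `+` q) = total f p + total f q.
Proof.
rewrite /total -big_cat; apply: perm_big.
by apply/allP => x _ /=; rewrite count_cat !count_mem_mset msetE2.
Qed.

Lemma total1 f x : total f [mset x] = f x.
Proof. by rewrite /total enum_msetn big_seq1. Qed.

Lemma sum_sqr_le_sqr_sum (s : seq nat) :
  \sum_(x <- s) x ^ 2 <= (\sum_(x <- s) x) ^ 2.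
Proof. by elim: s => [|x s IH]; rewrite ?big_nil // !big_cons; nia. Qed.

(** For the moves that replace two entries by two, this is strict convexity of
    the square: two equal entries are spread apart around their mean. *)
Lemma trib_rule_total A B : trib_rule A B ->
  total id A = total id B /\ total (expn^~ 2) A < total (expn^~ 2) B.
Proof.
case=> [i hi|||||i hi]; rewrite !(totalD, total1) //=.
- case: i hi => [|[|[|i]]] // _.
  have -> : i.+3 - 2 = i.+1 by lia.
  have -> : i.+3 - 1 = i.+2 by lia.
  rewrite addn1 trib_rec.
  have := trib_ltS i; have := trib_ltS i.+1; have := trib_ltS i.+2.
  by move=> *; split; nia.
- case: i hi => [|[|[|[|i]]]] // _.
  have -> : i.+4 - 3 = i.+1 by lia.
  rewrite addn1; have dbl := trib_double i; split=> //.
  have := trib_ltS i.+1; have := trib_ltS i.+2; have := trib_ltS i.+3.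
  move: dbl.
  move: (trib i.+4.+1) (trib i.+4) (trib i.+3) (trib i.+2) (trib i.+1).
  by move=> *; nia.
Qed.

(** The sum of squares of a list never exceeds the square of its sum, and the
    difference of the two decreases at each move. *)
Lemma trib_move_terminating : terminating trib_move.
Proof.
pose defect p := total id p ^ 2 - total (expn^~ 2) p.
apply: (@Wf_nat.well_founded_lt_compat _ defect) => q p [A [B [AB Ap ->]]].
have [sumAB sqrAB] := trib_rule_total AB.
rewrite -{2}(msetBDK Ap) /defect.
have := sum_sqr_le_sqr_sum ((p `\` A) `+` B).
rewrite -/(total id _) -/(total (expn^~ 2) _) !totalD -sumAB; lia.
Qed.

(** * Moves among small Tribonacci numbers *)

Definition low (a b c d : nat) : position :=
  msetn a 1 `+` msetn b 2 `+` msetn c 4 `+` msetn d 7.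

Lemma lowE a b c d x :
  low a b c d x = (if x == 1 then a else 0) + (if x == 2 then b else 0)
                + (if x == 4 then c else 0) + (if x == 7 then d else 0).
Proof. by rewrite /low !msetE2 !msetnE. Qed.

(** The balance of multiplicities is written with additions on both sides so
    that truncated subtraction does not appear. *)
Lemma low_trib_moveP a b c d a' b' c' d' A B : trib_rule A B ->
  (forall x, A x <= low a b c d x) ->
  (forall x, low a b c d x + B x = low a' b' c' d' x + A x) ->
  trib_move (low a b c d) (low a' b' c' d').
Proof.
move=> AB leA eqAB; exists A, B; split=> //; first exact/msubsetP.
apply/msetP => x; move: (leA x) (eqAB x); rewrite /low !msetE2; lia.
Qed.

Ltac low_count := move=> x; rewrite ?lowE ?msetE2 ?msetnE /=;
  do ?case: eqP => ?; subst=> //; lia.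

Lemma move_11 a b c d : trib_move (low a.+2 b c d) (low a b.+1 c d).
Proof. by apply: (low_trib_moveP rule_11); low_count. Qed.

Lemma move_112 a b c d : trib_move (low a.+2 b.+1 c d) (low a b c.+1 d).
Proof. by apply: (low_trib_moveP rule_112); low_count. Qed.

Lemma move_124 a b c d : trib_move (low a.+1 b.+1 c.+1 d) (low a b c d.+1).
Proof. by apply: (low_trib_moveP (rule_consecutive (leqnn 3))); low_count. Qed.

Lemma move_44 a b c d : trib_move (low a b c.+2 d) (low a.+1 b c d.+1).
Proof. by apply: (low_trib_moveP rule_33); low_count. Qed.

(** Among 1, 4 and 7 with a single 7 at most, the only entries that a rule can
    take are two 1s or two 4s: a rule for three consecutive Tribonacci numbers
    takes a 2 or some entry above 7, and the rule for two equal entries needs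
    two 7s or entries above 7. *)
Lemma no_two_move a c d q : d <= 1 -> trib_move (low a 0 c d) q ->
  [/\ 2 <= a & q = low (a - 2) 1 c d]
  \/ [/\ 2 <= c & q = low a.+1 0 (c - 2) d.+1].
Proof.
move=> d1 [A [B [AB /msubsetP leA ->]]].
have no2 : 0 < A 2 -> False by have := leA 2; rewrite lowE /=; lia.
have no_big i : 5 <= i -> 0 < A (trib i) -> False.
  move=> /trib_gt7 gt7; have := leA (trib i); rewrite lowE.
  by do 4?[case: eqP => ?; first lia]; lia.
case: AB leA no2 no_big => [i hi|||||i hi] leA no2 no_big.
- case: (leqP 5 i) => [/no_big[]|i4]; first by rewrite !msetE2 !msetnE eqxx; lia.
  (* Here i is 3 or 4, and both triples contain 2. *)
  case: no2; case: i hi i4 leA no_big => [|[|[|[|[|i]]]]] //= *.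
    by rewrite !msetE2 !msetnE.
  by rewrite !msetE2 !msetnE.
- by case: no2; rewrite !msetE2 !msetnE.
- left; have := leA 1; rewrite lowE !msetE2 !msetnE /= => a2.
  have {}a2 : 2 <= a by lia.
  by split=> //; apply/msetP; low_count.
- by case: no2; rewrite !msetE2 !msetnE.
- right; have := leA 4; rewrite lowE !msetE2 !msetnE /= => c2.
  have {}c2 : 2 <= c by lia.
  by split=> //; apply/msetP; low_count.
- case: (leqP 5 i) => [/no_big[]|i4]; first by rewrite !msetE2 !msetnE eqxx; lia.
  have i4E : i = 4 by lia.
  by have := leA 7; rewrite i4E lowE !msetE2 !msetnE /=; lia.
Qed.

(** * Strategy stealing *)

Lemma start_losing m : losing trib_move (low m.+4.+4.+2 0 0 0).
Proof.
apply: NNPP => /(not_losing_winning trib_move_terminating) start_win.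
have l1 : losing trib_move (low m.+4.+4 1 0 0).
  have [q [/no_two_move[] // [] // _ ->]] := (winningP _ _).1 start_win.
  by rewrite !subSS subn0.
have l2 : losing trib_move (low m.+4 1 1 0).
  have [q [/no_two_move[] // [] // _ ->]] :=
    (winningP _ _).1 (l1 _ (move_112 m.+4.+2 0 0 0)).
  by rewrite !subSS subn0.
have w7 : winning trib_move (low m.+3 0 0 1) := l2 _ (move_124 m.+3 0 0 0).
have l3 : losing trib_move (low m.+1 1 0 1).
  have [q [/no_two_move[] // [] // _ ->]] := (winningP _ _).1 w7.
  by rewrite !subSS subn0.
have [q [/no_two_move[] // [] // _ -> l4]] :=
  (winningP _ _).1 (l2 _ (move_112 m.+2 0 1 0)).
  (* The successor (m, 1, 2, 0) reaches the losing (m+1, 1, 0, 1). *)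
  apply: losing_not_winning l3 (l4 _ _).
  by rewrite !subSS subn0; apply: move_44.
exact: losing_not_winning l4 w7.
Qed.

Theorem lemma1p4 (n : nat) (hn : 9 < n) :
  has_winning_strategy trib_move (trib_start n) Player2.
Proof.
have -> : trib_start n = low (n - 10).+4.+4.+2 0 0 0.
  by rewrite /low !msetn0 !msetD0 /trib_start; congr msetn; lia.
apply: (losing_second_player_wins trib_move_terminating (@start_losing _)).
by move=> term; apply: term (move_11 _ _ _ _).
Qed.
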